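(* Let $\Lambda\subset\mathbb{Z}^d$ be finite and nonempty. For every $x\in\Lambda$ and $u\in[0,1)$, the addition operator $A_x^u$ is a bijection on $\mathcal{R}$ (the set of allowed configurations), and $\mu$ (normalized Lebesgue measure on $\mathcal{R}$) is $A_x^u$-invariant, i.e. $\mu\{\eta\in\mathcal{R}: A_x^u\eta\in B\}=\mu(B)$ for every measurable $B\subset\mathcal{R}$. Hence, $\mu$ is invariant for the CBTW sandpile model (for all $[a,b]\subset[0,1]$).
   Context: Let $d\ge 1$ and let $\Lambda\subset\mathbb{Z}^d$ be finite and nonempty. Sites $x,y$ are nearest neighbours if $|x-y|=1$ (Euclidean norm). Put $\mathcal{X}=[0,\infty)^\Lambda$ (configurations) and $\Omega=[0,1)^\Lambda$ (stable configurations). Let $\Delta$ be the $|\Lambda|\times|\Lambda|$ matrix with $\Delta(x,x)=1$, $\Delta(x,y)=-\frac1{2d}$ if $|x-y|=1$, and $\Delta(x,y)=0$ otherwise. The toppling operator at $x$ is $T_x\eta=\eta-\Delta(x,\cdot)$; it is legal on $\eta$ if $\eta(x)\ge 1$. It is a known fact that from every $\eta\in\mathcal{X}$, performing legal topplings leads after finitely many steps to a stable configuration, which does not depend on the order of the legal topplings; it is denoted $\mathcal{S}\eta\in\Omega$ (stabilization). With $\delta_x$ the indicator configuration of site $x$, the addition operator is $A_x^u\eta=\mathcal{S}(\eta+u\delta_x)$ for $u\ge 0$. The CBTW sandpile model with parameters $[a,b]\subset[0,1]$ is the Markov chain $\eta_t=A_{X_t}^{U_t}\eta_{t-1}$, $t=1,2,\dots$,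 on $\Omega$, where $X_1,X_2,\dots$ are i.i.d. uniform on $\Lambda$, $U_1,U_2,\dots$ are i.i.d. uniform on $[a,b]$ ($U_t=a$ if $a=b$), and the two sequences and the initial configuration $\eta_0$ are independent. For $\eta\in\Omega$ and nonempty $W\subseteq\Lambda$, the restriction $\eta|_W$ is a forbidden sub-configuration (FSC) if for all $x\in W$, $\eta(x)<\frac1{2d}\#\{\text{nearest neighbours of }x\text{ in }W\}$. A configuration $\eta\in\Omega$ is allowed if it has no FSC. $\mathcal{R}$ is the set of allowed configurations, and $\mu$ is the probability measure $\mu(B)=\mathrm{Vol}(B)/\mathrm{Vol}(\mathcal{R})$ for measurable $B\subset\mathcal{R}$, where $\mathrm{Vol}$ is Lebesgue measure. *)

(* Defs.v *)
From HB Require Import structures.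
From mathcomp Require Import all_boot all_order all_algebra finmap.
From mathcomp Require Import all_classical all_reals all_analysis.

Set Implicit Arguments.
Unset Strict Implicit.
Unset Printing Implicit Defensive.

Import Order.TTheory GRing.Theory Num.Theory.
Import numFieldNormedType.Exports.

Local Open Scope classical_set_scope.
Local Open Scope ring_scope.

(* Lebesgue measure on R^n as the n-fold product of the one-dimensional one;
   R^0 is a single point of mass 1. *)
Fixpoint tuple_volume (R : realType) (n : nat) : set (n.-tuple R) -> \bar R :=
  match n with
  | 0 => fun A => \d_([tuple] : 0.-tuple R) A
  | m.+1 => fun A => (@lebesgue_measure R \x @tuple_volume R m)%E
                       [set p : R * m.-tuple R | A (cons_tuple p.1 p.2)]
  end.

Section configurations.
Variables (R : realType) (d : nat) (Lam : {fset 'rV[int]_d}).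

Definition config : Type := {ffun Lam -> R}.

HB.instance Definition _ := Choice.on config.
HB.instance Definition _ := isPointed.Build config [ffun=> 0].

(* The product Borel sigma-algebra: generated by the coordinate maps. *)
Definition config_cylinders : set (set config) :=
  \bigcup_(x in [set: Lam])
    preimage_set_system setT (fun eta : config => eta x) measurable.

Definition config_display : measure_display := sigma_display config_cylinders.

HB.instance Definition _ := @isMeasurable.Build config_display config
  <<s config_cylinders >> (@sigma_algebra0 _ setT config_cylinders)
  (@sigma_algebraC _ config_cylinders)
  (@sigma_algebra_bigcup _ setT config_cylinders).

(* Lebesgue measure on R^Lam, transported from R^#|Lam| along the enumeration
   of Lam (the choice of enumeration is immaterial). *)
Definition volume (B : set config) : \bar R :=
  tuple_volume [set t : #|{: Lam}|.-tuple R | B (Finfun t)].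

Definition euclid_norm (v : 'rV[int]_d) : R :=
  Num.sqrt (\sum_i (v 0 i)%:~R ^+ 2).

Definition neighbour (x y : Lam) : bool := euclid_norm (val x - val y) == 1.

Definition laplacian (x y : Lam) : R :=
  if x == y then 1 else if neighbour x y then - (2 * d)%:R^-1 else 0.

Definition stable (eta : config) : Prop := forall x, 0 <= eta x < 1.

Definition topple (eta : config) (x : Lam) : config :=
  [ffun y => eta y - laplacian x y].

Fixpoint legal (eta : config) (s : seq Lam) : bool :=
  if s is x :: s' then (1 <= eta x) && legal (topple eta x) s' else true.

(* The stable configuration reached by legal topplings; it exists and is
   unique whenever all heights of eta are nonnegative.  The default value is
   used only if eta has negative heights and no such configuration exists. *)
Definition stabilize (eta : config) : config :=
  xget point [set xi | stable xi /\
                       exists s, legal eta s /\ xi = foldl topple eta s].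

Definition add_op (x : Lam) (u : R) (eta : config) : config :=
  stabilize [ffun y => eta y + u * (y == x)%:R].

Definition forbidden (eta : config) (W : {set Lam}) : Prop :=
  forall x, x \in W ->
    eta x < (2 * d)%:R^-1 * #|[pred y in W | neighbour x y]|%:R.

Definition allowed : set config :=
  [set eta | stable eta /\
             ~ exists W : {set Lam}, W != finset.set0 /\ forbidden eta W].

(* Normalized Lebesgue measure on the allowed configurations, extended by 0 to
   a measure on all configurations. *)
Definition mu_allowed (B : set config) : \bar R :=
  (volume (B `&` allowed) * (fine (volume allowed))^-1%:E)%E.

End configurations.

Arguments allowed : clear implicits.
Arguments mu_allowed : clear implicits.

Section independence.
Context (R : realType) (d : measure_display) (T : measurableType d).
Variable P : probability T R.

Definition independent (I : choiceType) (F : I -> set (set T)) : Prop :=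
  forall (J : {fset I}) (A : I -> set T),
    (forall i, i \in J -> F i (A i)) ->
    P (\bigcap_(i in [set` J]) A i) = (\prod_(i <- J) P (A i))%E.

Definition has_uniform_law (a b : R) (U : {RV P >-> R}) : Prop :=
  (forall ab : a < b, forall B : set R, measurable B ->
     distribution P U B = uniform_prob ab B) /\
  (a = b -> forall B : set R, measurable B -> distribution P U B = \d_a B).

End independence.

Section CBTW.
Variables (R : realType) (d : nat) (Lam : {fset 'rV[int]_d}) (a b : R).

Section process.
Context (disp : measure_display) (T : measurableType disp).
Variable P : probability T R.

(* Sigma-algebras generated by X t (Lam being discrete) and by U t. *)
Definition sigma_site (X : nat -> T -> Lam) (t : nat) : set (set T) :=
  preimage_set_system setT (X t) setT.

Definition sigma_real (U : nat -> {RV P >-> R}) (t : nat) : set (set T) :=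
  preimage_set_system setT (U t) measurable.

(* X t and U t drive the step from time t to time t.+1. *)
Record CBTW_chain (X : nat -> T -> Lam) (U : nat -> {RV P >-> R})
    (eta : nat -> T -> config R Lam) : Prop := {
  site_measurable : forall t (S : set Lam), measurable (X t @^-1` S) ;
  site_uniform : forall t (x : Lam),
    P (X t @^-1` [set x]) = (#|{: Lam}|%:R^-1)%:E ;
  site_independent : independent P (sigma_site X) ;
  amount_uniform : forall t, has_uniform_law a b (U t) ;
  amount_independent : independent P (sigma_real U) ;
  initial_measurable : measurable_fun setT (eta 0%N) ;
  initial_stable : forall w, stable (eta 0%N w) ;
  joint_independent : independent P (fun i : 'I_3 => nth set0
    [:: <<s \bigcup_t sigma_site X t >>;
        <<s \bigcup_t sigma_real U t >>;
        preimage_set_system setT (eta 0%N) measurable] i) ;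
  chain_step : forall t w, eta t.+1 w = add_op (X t w) (U t w) (eta t w)
}.

End process.

Definition CBTW_invariant (m : set (config R Lam) -> \bar R) : Prop :=
  forall (disp : measure_display) (T : measurableType disp)
    (P : probability T R) (X : nat -> T -> Lam) (U : nat -> {RV P >-> R})
    (eta : nat -> T -> config R Lam),
  CBTW_chain X U eta ->
  (forall B, measurable B -> P (eta 0%N @^-1` B) = m B) ->
  forall t, measurable_fun setT (eta t) /\
    forall B, measurable B -> P (eta t @^-1` B) = m B.

End CBTW.

(* Main.v *)
(* Write Delta for the lattice Laplacian restricted to Lam; a toppling at [x]
   subtracts the row Delta(x, .).

   Two allowed configurations xi and xi - Delta m with [m] integer coincide:
   if max m > 0, the set where [m] is maximal is a forbidden sub-configuration
   of xi - Delta m, and exchanging the two configurations gives m >= 0.  On the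
   other hand g = C - |x|^2 satisfies Delta g >= 1, so every class of
   configurations modulo the integer combinations of the rows of Delta contains
   a configuration with all heights >= 1, which has no forbidden
   sub-configuration and stabilizes to an allowed one.  Hence each class
   contains exactly one allowed configuration; as the addition operator acts on
   classes as the translation by u delta_x, it permutes the allowed
   configurations.  Being injective and a translation on each of the countably
   many sets of configurations stabilized by a given legal sequence, it
   preserves volume.

   For the chain, one shows by induction on t that eta_t has law mu and is
   independent of the cylinders in (X_s, U_s) for s >= t: restricted to such a
   cylinder and to X_t = x, the law of (U_t, eta_t) is a product measure, so its
   image under (u, eta) |-> A_x^u eta is computed by Fubini. *)
From HB Require Import structures.
Require Import Defs.
From mathcomp Require Import all_boot all_order all_algebra finmap.
From mathcomp Require Import all_classical all_reals all_analysis.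
From mathcomp Require Import zify ring lra.

Set Implicit Arguments.
Unset Strict Implicit.
Unset Printing Implicit Defensive.

Import Order.TTheory GRing.Theory Num.Theory.

Local Open Scope classical_set_scope.
Local Open Scope ring_scope.

(** * Nearest neighbours and the Laplacian *)

Section lattice.
Variables (R : realType) (d : nat).

(** The boolean carries the sign, so that the 2d unit vectors are indexed by a finite type. *)
Definition unit_step (p : 'I_d * bool) : 'rV[int]_d :=
  (-1) ^+ p.2 *: delta_mx 0 p.1.

Definition sqnorm (v : 'rV[int]_d) : int := \sum_i (v 0 i) ^+ 2.

Lemma sqnorm_ge0 v : 0 <= sqnorm v.
Proof. by apply: sumr_ge0 => i _; rewrite sqr_ge0. Qed.

(** A nonzero integer coordinate already contributes at least 1 to the sum, so the others vanish and
    this one is 1 or -1. *)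
Lemma sqnorm_eq1 v : sqnorm v = 1 -> exists p, v = unit_step p.
Proof.
move=> v1.
have [i vi0] : exists i, v 0 i != 0.
  apply/existsP; apply: contraPT v1; rewrite negb_exists => /forallP v0.
  rewrite /sqnorm big1// => i _; have := v0 i; rewrite negbK => /eqP ->.
  by rewrite expr0n.
have vi1 : 1 <= v 0 i ^+ 2 by rewrite -gtz0_ge1 exprn_even_gt0.
move: v1; rewrite /sqnorm (bigD1 i)//= => v1.
have rest0 : \sum_(j | j != i) v 0 j ^+ 2 = 0.
  by apply/eqP; rewrite eq_le; apply/andP; split;
    [lra | apply: sumr_ge0 => j _; rewrite sqr_ge0].
have vj0 j : j != i -> v 0 j = 0.
  move=> ji; apply/eqP; rewrite -sqrf_eq0; apply/eqP.
  by apply: (psumr_eq0P _ rest0) => // k _; rewrite sqr_ge0.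
move: v1; rewrite rest0 addr0 => /eqP; rewrite sqrf_eq1 => vi.
exists (i, v 0 i == -1); apply/rowP => j; rewrite !mxE/=.
case: (eqVneq j i) => [->|ji]; last by rewrite mulr0 vj0.
by rewrite mulr1; case/orP: vi => /eqP ->.
Qed.

(** On each axis the cross terms of the two opposite steps cancel. *)
Lemma sum_sqnorm_steps v :
  \sum_(p : 'I_d * bool) sqnorm (v + unit_step p) =
  (sqnorm v + 1) *+ (2 * d).
Proof.
have step i : sqnorm (v + unit_step (i, true)) +
    sqnorm (v + unit_step (i, false)) = (sqnorm v + 1) *+ 2.
  rewrite /sqnorm -big_split/= (bigD1 i)//= [in RHS](bigD1 i)//= !mxE !eqxx/=.
  rewrite (eq_bigr (fun j => v 0 j ^+ 2 *+ 2)).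
    by rewrite sumrMnl; ring.
  by move=> j /negbTE ji; rewrite !mxE ji andbF !mulr0 !addr0 mulr2n.
rewrite -(pair_bigA _ (fun i b => sqnorm (v + unit_step (i, b))))/=.
under eq_bigr do rewrite big_bool/= step.
by rewrite sumr_const card_ord -mulrnA.
Qed.

Variable Lam : {fset 'rV[int]_d}.
Implicit Types x y : Lam.

Lemma neighbourE x y : neighbour R x y = (sqnorm (val x - val y) == 1).
Proof.
rewrite /neighbour /euclid_norm.
have -> : \sum_i ((val x - val y) 0 i)%:~R ^+ 2 =
    (sqnorm (val x - val y))%:~R :> R.
  by rewrite /sqnorm rmorph_sum; apply: eq_bigr => i _; rewrite rmorphXn.
have := sqnorm_ge0 (val x - val y); set n := sqnorm _ => n0.
apply/eqP/eqP => [n1|->]; last by rewrite sqrtr1.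
apply/eqP; rewrite -(eqr_int R); apply/eqP.
by rewrite -[LHS]sqr_sqrtr ?ler0z// n1 expr1n.
Qed.

Lemma neighbour_sym x y : neighbour R x y = neighbour R y x.
Proof.
by rewrite !neighbourE -opprB /sqnorm; under eq_bigr do rewrite mxE sqrrN.
Qed.

Lemma neighbour_irr x : neighbour R x x = false.
Proof.
by rewrite neighbourE subrr /sqnorm big1// => i _; rewrite mxE expr0n.
Qed.

Lemma neighbour_step x y : neighbour R x y ->
  exists p, val y = val x + unit_step p.
Proof.
rewrite neighbour_sym neighbourE => /eqP/sqnorm_eq1[p yx].
by exists p; rewrite -yx addrC subrK.
Qed.

(** Lattice neighbours of [x] may lie outside [Lam]; they appear on the right only, where [f] is
    nonnegative. *)
Lemma ler_sum_neighbour x (f : 'rV[int]_d -> R) :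
  (forall p, 0 <= f (val x + unit_step p)) ->
  \sum_(y | neighbour R x y) f (val y) <=
  \sum_(p : 'I_d * bool) f (val x + unit_step p).
Proof.
move=> f0.
(* Double counting of incidences: a neighbour is reached by at least one step, and a step reaches at
   most one site. *)
pose F y p := (val y == val x + unit_step p)%:R * f (val x + unit_step p).
have F0 y p : 0 <= F y p by rewrite mulr_ge0 ?ler0n.
apply: (@le_trans _ _ (\sum_y \sum_p F y p)).
  rewrite big_mkcond/=; apply: ler_sum => y _; case: ifPn => [xy|_]; last first.
    exact: sumr_ge0.
  have [p yp] := neighbour_step xy.
  by rewrite (bigD1 p)//= {1}/F -yp eqxx mul1r lerDl sumr_ge0.
rewrite exchange_big/=; apply: ler_sum => p _; rewrite -mulr_suml.
rewrite -[leRHS]mul1r ler_wpM2r// -natr_sum lern1.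
have [[y yp]|ne] := pselect (exists y : Lam, val y = val x + unit_step p).
  rewrite (bigD1 y)//= yp eqxx big1// => z zy; apply/eqP; rewrite eqb0 -yp.
  by rewrite (inj_eq val_inj).
rewrite big1// => y _; apply/eqP; rewrite eqb0; apply/eqP => yp.
by apply: ne; exists y.
Qed.

Lemma card_neighbour x : (#|[pred y | neighbour R x y]| <= 2 * d)%N.
Proof.
have := @ler_sum_neighbour x (fun=> 1) (fun=> ler01).
rewrite (eq_bigl (mem [pred y | neighbour R x y]))// !sumr_const ler_nat.
move=> /leq_trans; apply.
by rewrite card_prod card_ord card_bool mulnC.
Qed.

End lattice.

(** * The toppling matrix and a superharmonic function *)

Section laplacian.
Variables (R : realType) (d : nat) (hd : (0 < d)%N) (Lam : {fset 'rV[int]_d}).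
Implicit Types (x y : Lam) (eta : config R Lam).

Lemma laplacian_diag x : laplacian R x x = 1.
Proof. by rewrite /laplacian eqxx. Qed.

Lemma laplacian_offdiag x y : x != y -> laplacian R x y <= 0.
Proof.
by move=> /negbTE xy; rewrite /laplacian xy; case: ifP.
Qed.

Lemma laplacian_sym x y : laplacian R x y = laplacian R y x.
Proof. by rewrite /laplacian eq_sym neighbour_sym. Qed.

Lemma sum_laplacian (m : Lam -> R) x :
  \sum_y m y * laplacian R y x =
  m x - (2 * d)%:R^-1 * \sum_(y | neighbour R x y) m y.
Proof.
rewrite (bigD1 x)//= laplacian_diag mulr1; congr (_ + _).
rewrite mulr_sumr -sumrN [LHS]big_mkcond [RHS]big_mkcond/=.
apply: eq_bigr => y _; rewrite /laplacian [neighbour R y x]neighbour_sym.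
case: eqVneq => [->|_]; first by rewrite neighbour_irr.
by case: ifP => // _; rewrite ?mulr0// mulrN mulrC.
Qed.

(* [C - |x|^2] works, since averaging [|.|^2] over the 2d neighbours of [x]
   gives [|x|^2 + 1]. *)
Lemma superharmonic :
  exists g : Lam -> nat, forall x, 1 <= \sum_y (g y)%:R * laplacian R y x.
Proof.
pose S (x : Lam) := \sum_(p : 'I_d * bool) sqnorm (val x + unit_step p).
(* A sum of nonnegative terms bounds each of them, so [C] dominates |.|^2 on [Lam] and on all
   lattice neighbours of its sites. *)
pose C := \sum_(x : Lam) (sqnorm (val x) + S x).
have S0 x : 0 <= S x by apply: sumr_ge0 => p _; exact: sqnorm_ge0.
have CE x : sqnorm (val x) + S x <= C.
  rewrite /C (bigD1 x)//= lerDl; apply: sumr_ge0 => y _.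
  by rewrite addr_ge0 ?sqnorm_ge0.
have Cx (x : Lam) : sqnorm (val x) <= C.
  by apply: le_trans (CE x); rewrite lerDl.
have Cp (x : Lam) p : sqnorm (val x + unit_step p) <= C.
  apply: le_trans (CE x); rewrite /S (bigD1 p)//= addrCA lerDl addr_ge0//.
    exact: sqnorm_ge0.
  by apply: sumr_ge0 => q _; exact: sqnorm_ge0.
pose f (v : 'rV[int]_d) : R := (C - sqnorm v)%:~R.
exists (fun x => `|C - sqnorm (val x)|%N) => x.
have fE (y : Lam) : `|C - sqnorm (val y)|%N%:R = f (val y).
  by rewrite natr_absz ger0_norm ?subr_ge0.
under eq_bigr do rewrite fE.
rewrite (sum_laplacian (fun y => f (val y))).
have d0 : 0 < (2 * d)%:R :> R by rewrite ltr0n muln_gt0.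
have : \sum_(y | neighbour R x y) f (val y) <= (f (val x) - 1) * (2 * d)%:R.
  apply: le_trans (ler_sum_neighbour _) _.
    by move=> p; rewrite ler0z subr_ge0.
  rewrite le_eqVlt; apply/orP; left; apply/eqP.
  rewrite -rmorph_sum/= sumrB sum_sqnorm_steps sumr_const card_prod card_ord.
  rewrite card_bool [(d * 2)%N]mulnC -mulrnBl rmorphMn/= mulr_natr.
  by rewrite opprD addrA rmorphB.
rewrite -ler_pdivrMr// => h.
by rewrite lerBrDr addrC -lerBrDr mulrC.
Qed.

End laplacian.

(** * Stabilization and allowed configurations *)

Section sandpile.
Variables (R : realType) (d : nat) (Lam : {fset 'rV[int]_d}).
Implicit Types (x y : Lam) (eta xi zeta : config R Lam) (s : seq Lam).

(** Signed numbers of topplings without any legality condition: the orbits are the classes modulo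
    integer combinations of rows of Delta. *)
Definition topple_by eta (m : Lam -> int) : config R Lam :=
  [ffun y => eta y - \sum_x (m x)%:~R * laplacian R x y].

Lemma topple_byE eta m y :
  topple_by eta m y = eta y - \sum_x (m x)%:~R * laplacian R x y.
Proof. exact: ffunE. Qed.

Lemma toppleE eta x y : topple eta x y = eta y - laplacian R x y.
Proof. exact: ffunE. Qed.

Lemma topple_by0 eta : topple_by eta (fun=> 0) = eta.
Proof.
by apply/ffunP => y; rewrite topple_byE big1 ?subr0// => x _; rewrite mul0r.
Qed.

Lemma topple_byD eta m n :
  topple_by (topple_by eta m) n = topple_by eta (fun x => m x + n x).
Proof.
apply/ffunP => y; rewrite !topple_byE -addrA -opprD -big_split/=.
by congr (_ - _); apply: eq_bigr => x _; rewrite rmorphD mulrDl.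
Qed.

Lemma topple_byNK eta m : topple_by (topple_by eta m) (fun x => - m x) = eta.
Proof.
by rewrite topple_byD -[RHS]topple_by0; congr topple_by; apply/funext => x;
  rewrite subrr.
Qed.

Lemma foldl_toppleE s eta :
  foldl (@topple R d Lam) eta s = topple_by eta (fun x => (count_mem x s)%:Z).
Proof.
elim: s eta => [|x s IH] eta; first by rewrite /= topple_by0.
have -> : topple_by eta (fun z => (count_mem z (x :: s))%:Z) =
    topple_by (topple_by eta (fun z => (z == x)%:Z))
              (fun z => (count_mem z s)%:Z).
  rewrite topple_byD; congr topple_by; apply/funext => z /=.
  by rewrite PoszD eq_sym.
rewrite /= IH; congr topple_by; apply/ffunP => y.
rewrite toppleE topple_byE (bigD1 x)//= eqxx mul1r big1 ?addr0// => z.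
by move=> /negbTE ->; rewrite mul0r.
Qed.

(** * Least action and uniqueness of the stabilization *)

Lemma legal_rcons eta s z :
  legal eta (rcons s z) = legal eta s && (1 <= foldl (@topple R d Lam) eta s z).
Proof. by elim: s eta => [|x s IH] eta /=; rewrite ?andbT// IH andbA. Qed.

(** Least action principle, by induction on the last toppling [z]. If [z] had already been toppled
    as often as in [s'], then, the other counts being at most those of [s'] and the off-diagonal
    entries nonpositive, its height would be at most the one after [s'], hence below 1, and toppling
    it would be illegal. *)
Lemma legal_count_le eta s s' : legal eta s ->
  (forall x, foldl (@topple R d Lam) eta s' x < 1) ->
  forall x, (count_mem x s <= count_mem x s')%N.
Proof.
elim/last_ind: s => // s z IH; rewrite legal_rcons => /andP[ls lz] s'1 x.
have le := IH ls s'1.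
rewrite -cats1 count_cat /= addn0.
case: eqVneq => [<-|_]; last by rewrite addn0.
rewrite addn1 ltn_neqAle le andbT; apply/eqP => zE.
have := s'1 z; apply/negP; rewrite -leNgt; apply: le_trans lz _.
rewrite !foldl_toppleE !topple_byE lerD2l lerN2; apply: ler_sum => y _.
have [->|yz] := eqVneq y z; first by rewrite zE.
by rewrite ler_wnM2r ?laplacian_offdiag// ler_int lez_nat.
Qed.

Lemma legal_stable_unique eta s s' : legal eta s -> legal eta s' ->
  stable (foldl (@topple R d Lam) eta s) ->
  stable (foldl (@topple R d Lam) eta s') ->
  foldl (@topple R d Lam) eta s = foldl (@topple R d Lam) eta s'.
Proof.
move=> ls ls' st st'; rewrite !foldl_toppleE; congr topple_by.
apply/funext => x; congr Posz; apply/eqP; rewrite eqn_leq.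
rewrite (legal_count_le ls) ?(legal_count_le ls')// => y.
  by have /andP[] := st y.
by have /andP[] := st' y.
Qed.

Lemma stabilizeE eta s : legal eta s ->
  stable (foldl (@topple R d Lam) eta s) ->
  stabilize eta = foldl (@topple R d Lam) eta s.
Proof.
move=> ls st; rewrite /stabilize; case: xgetP => [xi _ [xist [s' [ls' xiE]]]|].
  by rewrite xiE; apply: legal_stable_unique => //; rewrite -xiE.
by move=> /(_ (foldl (@topple R d Lam) eta s))[]; split => //; exists s.
Qed.

Lemma topple_ge0 eta x : 1 <= eta x -> (forall y, 0 <= eta y) ->
  forall y, 0 <= topple eta x y.
Proof.
move=> x1 eta0 y; rewrite toppleE subr_ge0.
have [<-|xy] := eqVneq x y; first by rewrite laplacian_diag.
exact: le_trans (laplacian_offdiag _ xy) (eta0 y).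
Qed.

(** * Forbidden sub-configurations under toppling *)

Definition no_fsc eta :=
  ~ exists W : {set Lam}, W != finset.set0 /\ forbidden eta W.

(** If [W] is forbidden after toppling [x], then [W] without [x] was forbidden before: a neighbour
    of [x] had 1/(2d) less height, and its threshold drops by at most 1/(2d) when [x] is removed. *)
Lemma no_fsc_topple eta x : 1 <= eta x -> no_fsc eta -> no_fsc (topple eta x).
Proof.
move=> x1 nf [W [W0 fW]]; apply: nf.
exists (W :\ x)%SET; split.
  (* [W] is not reduced to [x]: there the threshold would be 0, whereas the height of [x] after its
     legal toppling is nonnegative. *)
  apply: contraNneq W0 => W0.
  have Wx y : y \in W -> y = x.
    move=> yW; apply/eqP; apply: contraT => yx.
    by have := finset.in_set0 y; rewrite -W0 !inE yx yW.
  rewrite -finset.subset0; apply/fintype.subsetP => y yW.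
  have yx := Wx _ yW; rewrite {}yx in yW *.
  have := fW _ yW; rewrite toppleE laplacian_diag eq_card0 ?mulr0.
    by rewrite ltNge subr_ge0 x1.
  move=> z; rewrite !inE; apply/negP => /andP[/Wx ->].
  by rewrite neighbour_irr.
move=> y; rewrite !inE => /andP[yx yW].
have := fW y yW; rewrite toppleE /laplacian eq_sym (negbTE yx) neighbour_sym.
have/eq_card -> : [pred z in (W :\ x)%SET | neighbour R y z] =i
          [predD1 [pred z in W | neighbour R y z] & x].
  by move=> z; rewrite !inE andbA.
rewrite (cardD1 x [pred z in W | neighbour R y z]) !inE.
case: ifP => [yx1|yx0]; last first.
  by rewrite subr0 andbF add0n.
case: (boolP (x \in W)) => xW /=.
  by rewrite natrD mulrDr mulr1 opprK addrC ltrD2l.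
rewrite add0n opprK; apply: le_lt_trans.
by rewrite lerDl invr_ge0 ler0n.
Qed.

Lemma no_fsc_le eta xi : (forall x, eta x <= xi x) -> no_fsc eta -> no_fsc xi.
Proof.
move=> le nf [W [W0 fW]]; apply: nf; exists W; split => // x xW.
exact: le_lt_trans (le x) (fW x xW).
Qed.

Lemma no_fsc_foldl eta s : legal eta s -> no_fsc eta ->
  no_fsc (foldl (@topple R d Lam) eta s).
Proof.
elim: s eta => //= x s IH eta /andP[x1 ls] nf.
by apply: IH => //; exact: no_fsc_topple.
Qed.

(** * Existence of the stabilization; one allowed configuration per class *)

Hypothesis hd : (0 < d)%N.

(** The mass [phi] weighted by the superharmonic [g] is nonnegative and drops by at least 1 at each
    toppling; the induction is on an integer bound for it. *)
Lemma exists_stabilizing eta : (forall x, 0 <= eta x) ->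
  exists s, legal eta s /\ stable (foldl (@topple R d Lam) eta s).
Proof.
move=> eta0; have [g g1] := superharmonic R hd Lam.
pose phi (eta : config R Lam) := \sum_x (g x)%:R * eta x.
have [n] : exists n : nat, phi eta < n%:R.
  by exists (Num.truncn (phi eta)).+1; exact: truncnS_gt.
elim: n eta eta0 => [|n IH] eta eta0 lt.
  by move: lt; rewrite ltNge sumr_ge0// => x _; rewrite mulr_ge0 ?ler0n.
have [st|] := pselect (forall x, eta x < 1).
  by exists [::]; split => // x; rewrite eta0 st.
move=> /existsNP[x /negP]; rewrite -leNgt => x1.
have [|s [ls st]] := IH (topple eta x) (topple_ge0 x1 eta0).
  have -> : phi (topple eta x) = phi eta - \sum_y (g y)%:R * laplacian R y x.
    rewrite /phi -sumrB; apply: eq_bigr => y _.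
    by rewrite toppleE mulrBr laplacian_sym.
  by move: lt (g1 x); rewrite -natr1; lra.
by exists (x :: s); rewrite /= x1.
Qed.

Lemma allowed_stabilize eta : (forall x, 0 <= eta x) -> no_fsc eta ->
  allowed R d Lam (stabilize eta) /\ exists n, stabilize eta = topple_by eta n.
Proof.
move=> eta0 nf; have [s [ls st]] := exists_stabilizing eta0.
rewrite (stabilizeE ls st); split; first by split => //; exact: no_fsc_foldl.
by rewrite foldl_toppleE; eexists.
Qed.

(** At a site [z] where [m] attains a maximum [M >= 1], the new height is [xi z - M] plus 1/(2d)
    times the sum of [m] over the neighbours. With [k] neighbours in the maximal set this is below
    k/(2d), so that set is forbidden in [zeta]. *)
Lemma allowed_topple_by_le0 xi zeta m : stable xi -> allowed R d Lam zeta ->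
  zeta = topple_by xi m -> forall x, m x <= 0.
Proof.
move=> xist [_ nf] zE x; rewrite leNgt; apply/negP => x0; apply: nf.
pose y0 := [arg max_(y > x) m y]%O; pose M := m y0.
have Mge y : m y <= M.
  by rewrite /M /y0; case: Order.TotalTheory.arg_maxP => // z _ /(_ y); apply.
exists [set y | m y == M]%SET; split.
  by apply/set0Pn; exists y0; rewrite inE.
move=> z; rewrite inE => /eqP zM.
rewrite zE topple_byE (sum_laplacian (fun y => (m y)%:~R)) zM.
have M1 : 1 <= M by rewrite -gtz0_ge1; exact: lt_le_trans x0 (Mge x).
have d0 : 0 < (2 * d)%:R :> R by rewrite ltr0n muln_gt0.
set c := (2 * d)%:R^-1; have c0 : 0 < c by rewrite invr_gt0.
set k := #|_|.
(* By integrality a neighbour off the maximal set contributes at most [M - 1]; since [M - 1 >= 0],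
   the number of neighbours may be replaced by 2d. *)
have : \sum_(y | neighbour R z y) (m y)%:~R <=
    k%:R + (M - 1)%:~R * (2 * d)%:R :> R.
  apply: (@le_trans _ _ (\sum_(y | neighbour R z y)
      ((y \in [set y | m y == M]%SET)%:R + (M - 1)%:~R))).
    apply: ler_sum => y _; rewrite inE; have [->|yM] := eqVneq (m y) M.
      by rewrite rmorphB/= addrC subrK.
    by rewrite add0r ler_int; have := Mge y; move: yM; lia.
  rewrite big_split/= lerD//.
    rewrite -natr_sum ler_nat -big_mkcondr/= sum1_card.
    by apply: eq_leq; apply: eq_card => y; rewrite [RHS]inE andbC.
  rewrite sumr_const -[leLHS]mulr_natr ler_wpM2l ?ler_nat ?card_neighbour//.
  by rewrite ler0z subr_ge0.
move=> h.
have := xist z => /andP[_].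
have : c * (\sum_(y | neighbour R z y) (m y)%:~R) <=
       c * (k%:R + (M - 1)%:~R * (2 * d)%:R) by rewrite ler_pM2l.
rewrite mulrDr mulrCA mulVf ?gt_eqF// mulr1 rmorphB/=.
by lra.
Qed.

Lemma allowed_topple_by_eq eta zeta m : allowed R d Lam eta ->
  allowed R d Lam zeta -> zeta = topple_by eta m -> zeta = eta.
Proof.
move=> ha hz zE.
have m0 := allowed_topple_by_le0 ha.1 hz zE.
have m0' := allowed_topple_by_le0 hz.1 ha (m := fun x => - m x).
rewrite zE -[RHS]topple_by0; congr topple_by; apply/funext => x; apply/eqP.
rewrite eq_le m0 -oppr_le0 m0'//.
by rewrite zE topple_byNK.
Qed.

Lemma exists_allowed xi :
  exists eta m, allowed R d Lam eta /\ eta = topple_by xi m.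
Proof.
have [g g1] := superharmonic R hd Lam.
pose k := (Num.truncn (\sum_x `|1 - xi x|)).+1.
(* Toppling backwards [k * g] times raises every height by at least [k], and [k] exceeds every
   deficit [1 - xi x]. *)
pose zeta := topple_by xi (fun x => - (k * g x)%:Z).
have zeta1 x : 1 <= zeta x.
  rewrite /zeta topple_byE -sumrN.
  have -> : \sum_y - ((- (k * g y)%:Z)%:~R * laplacian R y x) =
            k%:R * \sum_y (g y)%:R * laplacian R y x.
    rewrite mulr_sumr; apply: eq_bigr => y _.
    by rewrite intrN mulNr opprK PoszM intrM mulrA.
  have : k%:R <= k%:R * \sum_y (g y)%:R * laplacian R y x.
    by rewrite ler_peMr ?ler0n.
  have : \sum_y `|1 - xi y| < k%:R by exact: truncnS_gt.
  have : `|1 - xi x| <= \sum_y `|1 - xi y|.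
    by rewrite (bigD1 x)//= lerDl sumr_ge0.
  by have := ler_norm (1 - xi x); lra.
have zeta0 x : 0 <= zeta x by exact: le_trans (zeta1 x).
have nf : no_fsc zeta.
  (* Thresholds never exceed 1, as a site has at most 2d neighbours. *)
  move=> [W [/set0Pn[x xW] fW]]; have := fW x xW; apply/negP.
  rewrite -leNgt; apply: le_trans (zeta1 x).
  rewrite mulrC ler_pdivrMr ?ltr0n ?muln_gt0// mul1r ler_nat.
  apply: leq_trans (card_neighbour R x); apply: subset_leq_card.
  by apply/fintype.subsetP => y; rewrite !inE => /andP[].
have [al [n nE]] := allowed_stabilize zeta0 nf.
exists (stabilize zeta), (fun x => - (k * g x)%:Z + n x); split => //.
by rewrite nE topple_byD.
Qed.

(** * The addition operator as a bijection *)

Definition add_height eta x (u : R) : config R Lam :=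
  [ffun y => eta y + u * (y == x)%:R].

Lemma add_opE x u eta : add_op x u eta = stabilize (add_height eta x u).
Proof. by []. Qed.

Lemma add_height_topple_by eta x u m :
  add_height (topple_by eta m) x u = topple_by (add_height eta x u) m.
Proof. by apply/ffunP => y; rewrite !ffunE addrAC. Qed.

Lemma add_heightK eta x u : add_height (add_height eta x u) x (- u) = eta.
Proof. by apply/ffunP => y; rewrite !ffunE mulNr addrK. Qed.

Lemma add_heightNK eta x u : add_height (add_height eta x (- u)) x u = eta.
Proof. by apply/ffunP => y; rewrite !ffunE mulNr subrK. Qed.

Lemma allowed_add_op x u eta : 0 <= u -> allowed R d Lam eta ->
  allowed R d Lam (add_op x u eta) /\
  exists n, add_op x u eta = topple_by (add_height eta x u) n.
Proof.
move=> u0 [st nf]; rewrite add_opE.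
have le y : eta y <= add_height eta x u y.
  by rewrite ffunE lerDl mulr_ge0 ?ler0n.
apply: allowed_stabilize (no_fsc_le le nf) => y.
by apply: le_trans (le y); have /andP[] := st y.
Qed.

(** Adding [u] at [x] commutes with [topple_by]. Equal images thus put the arguments in one class,
    where they coincide; a preimage of [zeta] is the allowed representative of the class of [zeta]
    with [u] removed at [x]. *)
Lemma add_op_bij x u : 0 <= u ->
  set_bij (allowed R d Lam) (allowed R d Lam) (add_op x u).
Proof.
move=> u0; split.
- by move=> eta ha; have [] := allowed_add_op x u0 ha.
- move=> eta eta'; rewrite !inE => ha ha'.
  have [_ [n ->]] := allowed_add_op x u0 ha.
  have [_ [n' ->]] := allowed_add_op x u0 ha'.
  rewrite -!add_height_topple_by => /(congr1 (fun z => add_height z x (- u))).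
  rewrite !add_heightK => nE.
  apply/esym; apply: (allowed_topple_by_eq ha ha' (m := fun x => n x - n' x)).
  by rewrite -topple_byD nE topple_byNK.
- move=> zeta hz.
  have [eta [m [ha etaE]]] := exists_allowed (add_height zeta x (- u)).
  exists eta => //; have [ha' [n nE]] := allowed_add_op x u0 ha.
  apply: (allowed_topple_by_eq hz ha' (m := fun x => m x + n x)).
  by rewrite nE etaE add_height_topple_by add_heightNK topple_byD.
Qed.

End sandpile.

(** * Lebesgue measure on tuples *)

Section measure_facts.
Context (R : realType).
Local Open Scope ereal_scope.

Lemma measurable_preimage disp disp' (T : measurableType disp)
    (T' : measurableType disp') (f : T -> T') (B : set T') :
  measurable_fun setT f -> measurable B -> measurable (f @^-1` B).
Proof. by move=> mf mB; rewrite -[X in measurable X]setTI; exact: mf. Qed.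

(** Product measures and their uniqueness are stated for bundled measures; the existential hides the
    bundling and keeps the underlying function. *)
Lemma sigma_finite_measure_pack d (T : measurableType d)
    (m : {measure set T -> \bar R}) : sigma_finite setT m ->
  exists m' : {sigma_finite_measure set T -> \bar R},
    m' = m :> (set T -> \bar R).
Proof.
move=> mfin.
pose sfin := isSFinite.Build _ _ _ _ (sfinite_measure_sigma_finite mfin).
pose sgfin := isSigmaFinite.Build _ _ _ _ mfin.
pose m' : {sigma_finite_measure set T -> \bar R} :=
  HB.pack_for (SigmaFiniteMeasure.type T R) (Measure.sort m) sfin sgfin.
by exists m'.
Qed.

Lemma sigma_finite_setT d (T : measurableType d)
    (m : {measure set T -> \bar R}) : m setT < +oo -> sigma_finite setT m.
Proof.
by move=> mT; exists (fun=> setT) => [|_]; [rewrite bigcup_const|split].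
Qed.

Lemma pushforward_measure_pack d d' (T : measurableType d)
    (T' : measurableType d') (m : {measure set T -> \bar R}) (f : T -> T') :
  measurable_fun setT f ->
  exists m' : {measure set T' -> \bar R}, forall A, m' A = m (f @^-1` A).
Proof.
move=> mf.
have [m' m'E] : exists m' : {measure set T' -> \bar R},
  m' = pushforward m f :> (set T' -> \bar R) 
  by unshelve (eexists; reflexivity).
by exists m' => A; rewrite m'E.
Qed.

(** An unnormalized conditional law, so that [G] may be a null event. *)
Lemma restricted_law_pack d d' (T : measurableType d) (T' : measurableType d')
    (P : probability T R) (G : set T) (f : T -> T') :
  measurable G -> measurable_fun setT f ->
  exists m : {sigma_finite_measure set T' -> \bar R},
    forall A, m A = P (f @^-1` A `&` G).
Proof.
move=> mG mf; have [m0 m0E] := pushforward_measure_pack (mrestr P mG) mf.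
have [|m mE] := @sigma_finite_measure_pack _ _ m0.
  apply: sigma_finite_setT; rewrite m0E /mrestr.
  apply: (@le_lt_trans _ _ (P setT)); last by rewrite probability_setT ltry.
  by apply: le_measure; rewrite ?inE// preimage_setT; exact: measurableI.
by exists m => A; rewrite mE m0E.
Qed.

Lemma measurable_translation (c : R) : measurable_fun setT
  ((fun x => x + c)%R : measurableTypeR R -> measurableTypeR R).
Proof.
apply: (@measurable_realfun.measurable_funD _ (measurableTypeR R) R setT
  idfun (cst c)).
  exact: measurable_id.
exact: measurable_cst.
Qed.

Lemma measurable_tuple_translation n (v : 'I_n -> R) : measurable_fun setT
  (fun t : n.-tuple R => [tuple (tnth t i + v i)%R | i < n]).
Proof.
apply/measurable_fun_tnthP => i.
rewrite (_ : _ \o _ = fun t : n.-tuple R => (tnth t i + v i)%R); last first.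
  by apply/funext => t; rewrite /= tnth_mktuple.
apply: (measurable_realfun.measurable_funD
  (f := fun t : n.-tuple R => tnth t i) (g := cst (v i))).
  exact: measurable_tnth.
exact: measurable_cst.
Qed.

(** The pushforward by a translation gives half-open intervals their length, which characterizes
    Lebesgue measure. *)
Lemma lebesgue_measure_translation (c : R) (A : set (measurableTypeR R)) :
  measurable A -> lebesgue_measure [set x | A (x + c)%R] = lebesgue_measure A.
Proof.
move=> mA.
have [m' m'E] :=
  pushforward_measure_pack lebesgue_measure (measurable_translation c).
rewrite -[LHS]m'E; apply/esym; apply: lebesgue_measure_unique => //.
move=> _ [[a b] _ <-]; rewrite m'E.
have -> : (fun x => x + c)%R @^-1` `]a, b] = `](a - c)%R, (b - c)%R]%classic.
  by apply/seteqP; split => x/=; rewrite !in_itv/= ltrBlDr lerBrDr.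
rewrite lebesgue_measure_itv [RHS]lebesgue_measure_itv/= !lte_fin ltrD2r.
by case: ifP => // _; rewrite -!EFinD; congr EFin; ring.
Qed.

(** The measure on tuples is the product measure transported along [cons_tuple]. Translation
    invariance passes from [n] to [n.+1] by uniqueness of product measures. *)
Lemma tuple_volume_measure n :
  exists mu : {sigma_finite_measure set (n.-tuple R) -> \bar R},
    (@tuple_volume R n = mu) /\
    forall (v : 'I_n -> R) (A : set (n.-tuple R)), measurable A ->
      mu [set t | A [tuple (tnth t i + v i)%R | i < n]] = mu A.
Proof.
elim: n => [|n [mu [muE muT]]].
  exists (\d_([tuple] : 0.-tuple R)); split => // v A _; congr (\d_ _ _).
  by apply/seteqP; split => t/=; rewrite (tuple0 [tuple _ | _ < _]) (tuple0 t).
pose pr : {measure set (measurableTypeR R * n.-tuple R)%type -> \bar R} :=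
  lebesgue_measure \x mu.
pose consf (p : measurableTypeR R * n.-tuple R) : n.+1.-tuple R :=
  cons_tuple p.1 p.2.
have mcons : measurable_fun setT consf.
  by apply: (@measurable_cons _ _ _ _ fst n snd).
pose uncons (t : n.+1.-tuple R) : measurableTypeR R * n.-tuple R :=
  (thead t, [tuple of behead t]).
have muncons : measurable_fun setT uncons.
  apply: measurable_fun_pair; last exact: measurable_behead.
  exact: measurable_tnth.
have consK : cancel consf uncons.
  by move=> [x t]; rewrite /uncons/= theadE; congr pair; exact: val_inj.
have unconsK : cancel uncons consf.
  by move=> t; rewrite [RHS]tuple_eta; exact: val_inj.
have [m mE] := pushforward_measure_pack pr mcons.
have [|m' m'E] := @sigma_finite_measure_pack _ _ m.
  have /sigma_finiteP[F [FT ndF Ffin]] := sigma_finiteT (@lebesgue_measure R).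
  have /sigma_finiteP[G [GT ndG Gfin]] := sigma_finiteT mu.
  (* Both exhaustions increase, so a point lies in the rectangle whose index is the larger of its
     two indices. *)
  exists (fun k => uncons @^-1` (F k `*` G k)).
    apply/esym/seteqP; split => // t _.
    have [k1 _ Ft] : (\bigcup_k F k) (uncons t).1 by rewrite -FT.
    have [k2 _ Gt] : (\bigcup_k G k) (uncons t).2 by rewrite -GT.
    exists (maxn k1 k2) => //; split.
      by move: Ft; apply/subsetPset/ndF/leq_maxl.
    by move: Gt; apply/subsetPset/ndG/leq_maxr.
  move=> k; have [mF Fk] := Ffin k; have [mG Gk] := Gfin k; split.
    by apply: measurable_preimage => //; exact: measurableX.
  rewrite mE -comp_preimage (_ : uncons \o consf = id); last exact/funext.
  rewrite preimage_id /pr/= product_measure1E//.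
  by rewrite lte_mul_pinfty// ge0_fin_numE.
exists m'; split; first by apply/funext => A; rewrite m'E mE /= muE.
move=> v A mA; rewrite m'E !mE.
pose w i := v (lift ord0 i).
pose f (p : measurableTypeR R * n.-tuple R) : measurableTypeR R * n.-tuple R :=
  ((p.1 + v ord0)%R, [tuple (tnth p.2 i + w i)%R | i < n]).
have mf : measurable_fun setT f.
  apply: measurable_fun_pair.
    by apply: (measurableT_comp (measurable_translation _)).
  by apply: (measurableT_comp (measurable_tuple_translation _)).
have -> : consf @^-1` [set t | A [tuple (tnth t i + v i)%R | i < n.+1]] =
    f @^-1` (consf @^-1` A).
  apply/funext => p; rewrite /preimage /mkset; congr A.
  apply: eq_from_tnth => i; rewrite tnth_mktuple.
  case: (unliftP ord0 i) => [j|] ->; last by rewrite !tnth0.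
  by rewrite !tnthS tnth_mktuple.
have [pf pfE] := pushforward_measure_pack pr mf.
(* [f] is the translation by [v] read on head and tail; it suffices to compare the two measures on
   rectangles. *)
rewrite -pfE /pr/=; apply/esym; apply: product_measure_unique.
  move=> B C mB mC; rewrite pfE.
  have -> : f @^-1` (B `*` C) = [set x | B (x + v ord0)%R] `*`
      [set t | C [tuple (tnth t i + w i)%R | i < n]] by [].
  rewrite /pr/= product_measure1E//.
  - by congr (_ * _); [exact: lebesgue_measure_translation | exact: muT].
  - exact: measurable_preimage (measurable_translation _) mB.
  - exact: measurable_preimage (measurable_tuple_translation w) mC.
exact: measurable_preimage mcons mA.
Qed.

End measure_facts.

(** * Volume on the configuration space *)

Section configuration_space.
Variables (R : realType) (d : nat) (Lam : {fset 'rV[int]_d}).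
Implicit Types (x y : Lam) (eta xi zeta : config R Lam) (s : seq Lam).

Lemma measurable_height x :
  measurable_fun setT (fun eta : config R Lam => eta x).
Proof.
move=> _ Y mY; rewrite setTI; apply: sub_sigma_algebra.
by exists x => //; exists Y => //; rewrite setTI.
Qed.

Lemma measurable_fun_config disp (T : measurableType disp)
    (f : T -> config R Lam) :
  (forall x, measurable_fun setT (fun t => f t x)) -> measurable_fun setT f.
Proof.
move=> mf; apply: (measurability (@config_cylinders R d Lam)) => //.
move=> _ [_ [x _ [Y mY <-]] <-]; rewrite setTI.
have := mf x measurableT Y mY; rewrite setTI.
by congr measurable; rewrite setTI.
Qed.

Definition translate (c : Lam -> R) eta : config R Lam :=
  [ffun y => eta y + c y].

Lemma measurable_translate c : measurable_fun setT (translate c).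
Proof.
apply: measurable_fun_config => x.
rewrite (_ : (fun _ => _) = fun eta : config R Lam => eta x + c x); last first.
  by apply/funext => eta; rewrite ffunE.
apply: (measurable_realfun.measurable_funD
  (f := fun eta : config R Lam => eta x) (g := cst (c x))).
  exact: measurable_height.
exact: measurable_cst.
Qed.

Lemma measurable_Finfun :
  measurable_fun setT (Finfun : #|{: Lam}|.-tuple R -> config R Lam).
Proof.
apply: measurable_fun_config => x.
rewrite (_ : (fun _ => _) =
  fun t : #|{: Lam}|.-tuple R => tnth t (enum_rank x)).
  exact: measurable_tnth.
by apply/funext => t; rewrite ffunE.
Qed.

Lemma volume_measure : exists mu : {measure set (config R Lam) -> \bar R},
  (forall B, volume B = mu B) /\
  forall c B, measurable B -> mu (translate c @^-1` B) = mu B.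
Proof.
have [mu [muE muT]] := tuple_volume_measure R #|{: Lam}|.
have [m mE] := pushforward_measure_pack mu measurable_Finfun.
exists m; split; first by move=> B; rewrite mE /volume muE.
move=> c B mB; rewrite !mE -[RHS](muT (fun i => c (enum_val i))); last first.
  exact: measurable_preimage measurable_Finfun mB.
congr (mu _); apply/funext => t; rewrite /preimage /mkset; congr B.
by apply/ffunP => x; rewrite !ffunE tnth_mktuple enum_rankK.
Qed.

(** The pieces are first made disjoint. The image of each is its preimage under the inverse
    translation, hence measurable and of equal measure, and injectivity keeps the images
    disjoint. *)
Lemma piecewise_translation_measure
    (mu : {measure set (config R Lam) -> \bar R}) (D : set (config R Lam))
    (L : (set (config R Lam))^nat)
    (c : nat -> Lam -> R) (f : config R Lam -> config R Lam) :
  (forall c B, measurable B -> mu (translate c @^-1` B) = mu B) ->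
  measurable D -> (forall k, measurable (L k)) -> D `<=` \bigcup_k L k ->
  (forall k eta, D eta -> L k eta -> f eta = translate (c k) eta) ->
  set_inj D f -> mu (f @` D) = mu D.
Proof.
move=> muT mD mL DL fE finj.
pose P k := D `&` seqDU L k.
have mP k : measurable (P k).
  apply: measurableI => //; apply: measurableD => //.
  exact: bigsetU_measurable.
have tP : trivIset setT P.
  by apply: trivIset_setIl; exact: trivIset_seqDU.
have DP : D = \bigcup_k P k.
  by rewrite -setI_bigcupr -seqDU_bigcup_eq setIidl.
have fP k : f @` P k = translate (fun x => - c k x) @^-1` P k.
  have PE eta : P k eta -> f eta = translate (c k) eta.
    by move=> [Deta [Leta _]]; exact: fE.
  apply/seteqP; split => [_ [eta Peta <-]|eta Peta].
    rewrite PE// /preimage /mkset (_ : translate _ _ = eta)//.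
    by apply/ffunP => x; rewrite !ffunE addrK.
  exists (translate (fun x => - c k x) eta) => //; rewrite PE//.
  by apply/ffunP => x; rewrite !ffunE subrK.
have mfP k : measurable (f @` P k).
  by rewrite fP; apply: measurable_preimage; [exact: measurable_translate|].
rewrite {1}DP image_bigcup [in RHS]DP measure_bigcup//; last first.
  apply/trivIsetP => i j _ _ ij; apply/seteqP; split => // z [[eta Peta <-]].
  move=> [xi Pxi] /finj xiE; suff : (P i `&` P j) eta.
    by move/trivIsetP : tP => /(_ i j I I ij) ->.
  by split => //; rewrite -xiE// inE; [case: Pxi | case: Peta].
rewrite measure_bigcup//; apply: eq_eseriesr => k _.
by rewrite fP muT.
Qed.

End configuration_space.

(** * Measurability of the dynamics *)

Section measurable_dynamics.
Variables (R : realType) (d : nat) (Lam : {fset 'rV[int]_d}).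
Implicit Types (x y : Lam) (eta xi zeta : config R Lam) (s : seq Lam).

Lemma foldl_topple_translate eta s :
  foldl (@topple R d Lam) eta s =
  translate (fun y => - \sum_x (count_mem x s)%:Z%:~R * laplacian R x y) eta.
Proof. by rewrite foldl_toppleE. Qed.

Lemma measurable_foldl_topple s :
  measurable_fun setT (fun eta => foldl (@topple R d Lam) eta s).
Proof.
rewrite (_ : (fun _ => _) =
  translate (fun y => - \sum_x (count_mem x s)%:Z%:~R * laplacian R x y)).
  exact: measurable_translate.
by apply/funext => eta; rewrite foldl_topple_translate.
Qed.

Lemma measurable_legal s : measurable [set eta : config R Lam | legal eta s].
Proof.
elim: s => [|x s IH].
  rewrite (_ : [set _ | _] = setT); first exact: measurableT.
  by apply/seteqP; split.
rewrite (_ : [set _ | _] = (fun eta => eta x) @^-1` `[1, +oo[ `&`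
    (fun eta => topple eta x) @^-1` [set eta | legal eta s]).
  apply: measurableI; apply: measurable_preimage => //.
  - exact: measurable_height.
  - exact: measurable_translate.
apply/seteqP; split => eta /=.
  by move=> /andP[x1 ls]; rewrite in_itv/= andbT.
by rewrite in_itv/= andbT => -[-> ->].
Qed.

Lemma measurable_stable : measurable [set eta : config R Lam | stable eta].
Proof.
rewrite (_ : [set _ | _] = \bigcap_(x in [set: Lam])
    (fun eta => eta x) @^-1` `[0, 1[).
  apply: fin_bigcap_measurable => [|x _]; first exact: finite_finset.
  by apply: measurable_preimage => //; exact: measurable_height.
apply/seteqP; split => eta /= st x; last by have := st x I; rewrite /= in_itv.
by move=> _; rewrite /= in_itv/=; exact: st.
Qed.

Lemma measurable_allowed : measurable (allowed R d Lam).
Proof.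
rewrite (_ : allowed R d Lam = [set eta | stable eta] `\`
    \bigcup_(W in [set W : {set Lam} | W != finset.set0])
    \bigcap_(x in [set` W]) (fun eta : config R Lam => eta x) @^-1`
    `]-oo, ((2 * d)%:R^-1 * #|[pred y in W | neighbour R x y]|%:R)[).
  apply: measurableD; first exact: measurable_stable.
  apply: fin_bigcup_measurable => [|W _]; first exact: finite_finset.
  apply: fin_bigcap_measurable => [|x _]; first exact: finite_finset.
  by apply: measurable_preimage => //; exact: measurable_height.
apply/seteqP; split => eta [st nf]; split => //.
  by move=> [W W0 fW]; apply: nf; exists W; split.
by move=> [W [W0 fW]]; apply: nf; exists W.
Qed.

Definition stabilized_by s : set (config R Lam) :=
  [set eta | legal eta s /\ stable (foldl (@topple R d Lam) eta s)].

Lemma measurable_stabilized_by s : measurable (stabilized_by s).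
Proof.
apply: measurableI; first exact: measurable_legal.
exact: measurable_preimage (measurable_foldl_topple s) measurable_stable.
Qed.

(** On each of the countably many sets [stabilized_by s] the map is a fixed sequence of
    topplings. *)
Lemma measurable_stabilize : measurable_fun setT (@stabilize R d Lam).
Proof.
move=> _ B mB; rewrite setTI.
have mU : measurable (\bigcup_s stabilized_by s).
  apply: countable_bigcupT_measurable; first exact: countableP.
  exact: measurable_stabilized_by.
have -> : @stabilize R d Lam @^-1` B =
    \bigcup_s (stabilized_by s `&`
      (fun eta => foldl (@topple R d Lam) eta s) @^-1` B) `|`
    (* Elsewhere no stable configuration is reached and [stabilize] returns its default [point]. *)
    (~` (\bigcup_s stabilized_by s) `&` cst (point : config R Lam) @^-1` B).
  apply/seteqP; split => eta /=.
    move=> sB.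
    have [[s _ [ls st]]|ns] := pselect ((\bigcup_s stabilized_by s) eta).
      by left; exists s => //; split => //=; rewrite -(stabilizeE ls st).
    right; split => //; move: sB.
    rewrite /stabilize xgetPN// => xi [st [s [ls xiE]]].
    by apply: ns; exists s => //; split => //; rewrite -xiE.
  move=> [[s _ [[ls st] /=]]|[ns]]; first by rewrite (stabilizeE ls st).
  rewrite /stabilize xgetPN// => xi [st [s [ls xiE]]].
  by apply: ns; exists s => //; split => //; rewrite -xiE.
apply: measurableU.
  apply: countable_bigcupT_measurable; first exact: countableP.
  move=> s; apply: measurableI; first exact: measurable_stabilized_by.
  exact: measurable_preimage (measurable_foldl_topple s) mB.
apply: measurableI; first exact: measurableC.
by apply: measurable_preimage => //; exact: measurable_cst.
Qed.

(** Joint measurability in amount and configuration is what Fubini needs below. *)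
Lemma measurable_add_op_pair x :
  measurable_fun setT (fun p : R * config R Lam => add_op x p.1 p.2).
Proof.
apply: (measurableT_comp (f := @stabilize R d Lam)).
  exact: measurable_stabilize.
apply: measurable_fun_config => y.
rewrite (_ : (fun _ => _) =
  ((fun p : R * config R Lam => p.2 y) \+
   (fun p => p.1 * (y == x)%:R))); last first.
  by apply/funext => p; rewrite ffunE.
apply: measurable_realfun.measurable_funD.
  exact: (measurableT_comp (measurable_height y) measurable_snd).
apply: measurable_realfun.measurable_funM; first exact: measurable_fst.
exact: measurable_cst.
Qed.

Lemma measurable_add_op x u : measurable_fun setT (@add_op R d Lam x u).
Proof.
apply: (measurableT_comp (measurable_add_op_pair x) (g := fun eta => (u, eta))).
exact: measurable_pair1.
Qed.

(** * Volume preservation *)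

Hypothesis hd : (0 < d)%N.

Lemma volume_add_op x (u : R) (B : set (config R Lam)) : 0 <= u ->
  measurable B -> B `<=` allowed R d Lam ->
  volume [set eta | allowed R d Lam eta /\ B (add_op x u eta)] = volume B.
Proof.
move=> u0 mB BA; set D := [set _ | _].
have [afun ainj asurj] := add_op_bij hd x u0.
have mD : measurable D.
  apply: measurableI; first exact: measurable_allowed.
  exact: measurable_preimage (measurable_add_op x u) mB.
have [mu [muE muT]] := volume_measure R Lam.
have DB : add_op x u @` D = B.
  apply/seteqP; split => [_ [eta [_ ? <-]]//|zeta Bz].
  have [eta ha etaE] := asurj _ (BA _ Bz).
  by exists eta => //; split => //=; rewrite etaE.
rewrite !muE -[in RHS]DB; apply/esym.
(* Legal sequences are numbered by [pickle]; a number that codes no sequence gets the empty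
   piece. *)
pose c (k : nat) y := u * (y == x)%:R - (if choice.unpickle k is Some s then
  \sum_z (count_mem z s)%:Z%:~R * laplacian R z y else 0).
pose L k := if choice.unpickle k is Some s then
  (fun eta => add_height eta x u) @^-1` stabilized_by s else set0.
apply: (piecewise_translation_measure (L := L) (c := c)) => //.
- move=> k; rewrite /L; case: (choice.unpickle k) => // s.
  apply: measurable_preimage (measurable_stabilized_by s).
  exact: (measurable_translate (fun y => u * (y == x)%:R)).
- move=> eta [[st _] _].
  have [|s ls] := exists_stabilizing hd (eta := add_height eta x u).
    move=> y; rewrite ffunE addr_ge0 ?mulr_ge0 ?ler0n//.
    by have /andP[] := st y.
  by exists (choice.pickle s) => //; rewrite /L choice.pickleK.
- move=> k eta _; rewrite /L /c; case: (choice.unpickle k) => // s [ls st].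
  rewrite add_opE (stabilizeE ls st) foldl_toppleE.
  by apply/ffunP => y; rewrite !ffunE addrA.
- by move=> eta xi; rewrite !inE => -[ha _] [ha' _]; apply: ainj; rewrite inE.
Qed.

End measurable_dynamics.

(** * The Markov chain *)

Section mu_allowed_facts.
Variables (R : realType) (d : nat) (hd : (0 < d)%N) (Lam : {fset 'rV[int]_d}).

(** [B] need not consist of allowed configurations: [add_op] preserves [allowed], so both sides only
    see the allowed part of [B]. *)
Lemma mu_allowed_add_op (x : Lam) (u : R) (B : set (config R Lam)) : 0 <= u ->
  measurable B ->
  mu_allowed R d Lam (add_op x u @^-1` B) = mu_allowed R d Lam B.
Proof.
move=> u0 mB; rewrite /mu_allowed; congr (_ * _)%E.
have mBA := measurableI _ _ mB (@measurable_allowed R d Lam).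
rewrite -(volume_add_op hd x u0 mBA); last exact: subIsetr.
congr volume; apply/seteqP; split => eta /=.
  move=> [Beta ha]; split => //; split => //.
  by have [] := allowed_add_op hd x u0 ha.
by move=> [ha [Beta _]].
Qed.

End mu_allowed_facts.

Lemma independent3 (R : realType) disp (T : measurableType disp)
    (P : probability T R) (F0 F1 F2 : set (set T)) (A0 A1 A2 : set T) :
  independent P (fun i : 'I_3 => nth set0 [:: F0; F1; F2] i) ->
  F0 A0 -> F1 A1 -> F2 A2 ->
  P (A0 `&` A1 `&` A2) = (P A0 * P A1 * P A2)%E.
Proof.
move=> ind FA0 FA1 FA2.
pose o0 : 'I_3 := ord0; pose o1 : 'I_3 := lift ord0 ord0.
pose o2 : 'I_3 := ord_max.
pose J := (o0 |` (o1 |` [fset o2]))%fset.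
pose A (i : 'I_3) := nth set0 [:: A0; A1; A2] i.
have hJ i : i \in J -> nth set0 [:: F0; F1; F2] i (A i).
  by rewrite !inE => /or3P[] /eqP ->.
have := ind J A hJ; rewrite !big_fsetU1/= ?inE// big_seq_fset1/= muleA => <-.
congr (P _); apply/seteqP; split => w.
  by move=> [[A0w A1w] A2w] i; rewrite /= !inE => /or3P[] /eqP ->.
by move=> Aw; split; [split|]; [apply: (Aw o0)|apply: (Aw o1)|apply: (Aw o2)];
  rewrite /= !inE.
Qed.

Section uniform.
Context (R : realType) disp (T : measurableType disp) (P : probability T R).

(** Invariance under [add_op] is available for amounts [u >= 0], so negative amounts must be shown
    to be null. *)
Lemma uniform_law_negative (a b : R) (U : {RV P >-> R}) : 0 <= a -> a <= b ->
  has_uniform_law a b U -> P (U @^-1` `]-oo, 0[) = 0%E.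
Proof.
move=> a0 ab [Uab Ua].
have [altb|blea] := ltP a b.
  rewrite -[LHS]/(distribution P U _) (Uab altb)// /uniform_prob.
  apply: integral0_eq => x; rewrite /= in_itv/= => x0.
  by rewrite /uniform_pdf leNgt (lt_le_trans x0 a0).
have aEb : a = b by apply/eqP; rewrite eq_le ab.
rewrite -[LHS]/(distribution P U _) (Ua aEb)// diracE memNset//=.
by rewrite in_itv/= => /(le_lt_trans a0); rewrite ltxx.
Qed.

End uniform.

(** * The stationary chain and its independence of the future *)

Section chain.
Variables (R : realType) (d : nat) (hd : (0 < d)%N) (Lam : {fset 'rV[int]_d}).
Variables (a b : R) (a0 : 0 <= a) (ab : a <= b).
Context disp (T : measurableType disp) (P : probability T R).
Variables (X : nat -> T -> Lam) (U : nat -> {RV P >-> R}).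
Variable eta : nat -> T -> config R Lam.
Hypothesis chain : CBTW_chain a b X U eta.

Lemma chain_preimageE t (B : set (config R Lam)) :
  eta t.+1 @^-1` B = \bigcup_(x in [set: Lam]) (X t @^-1` [set x] `&`
    (fun w => (U t w, eta t w)) @^-1`
      ((fun p : R * config R Lam => add_op x p.1 p.2) @^-1` B)).
Proof.
apply/seteqP; split => w; rewrite /preimage /= (chain_step chain).
  by move=> Bw; exists (X t w).
by move=> [x _ [-> ]].
Qed.

Lemma measurable_chain t : measurable_fun setT (eta t).
Proof.
elim: t => [|t IH]; first exact: (initial_measurable chain).
move=> _ B mB; rewrite setTI chain_preimageE.
apply: fin_bigcup_measurable => [|x _]; first exact: finite_finset.
apply: measurableI; first exact: (site_measurable chain).
apply: measurable_preimage; first exact: measurable_fun_pair.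
exact: measurable_preimage (measurable_add_op_pair x) mB.
Qed.

(** A cylinder over the times from [t] to [N - 1]; for [N <= t] it is the whole space. *)
Definition future t N (S : nat -> set Lam) (V : nat -> set R) : set T :=
  \bigcap_(s in [set s | (t <= s < N)%N]) (X s @^-1` S s `&` U s @^-1` V s).

Lemma measurable_future t N S V : (forall s, measurable (V s)) ->
  measurable (future t N S V).
Proof.
move=> mV; apply: fin_bigcap_measurable => [|s _].
  by apply: (@sub_finite_set _ _ `I_N) => // s /= /andP[].
apply: measurableI; first exact: (site_measurable chain).
exact: measurable_preimage.
Qed.

Lemma initial_independent N S V D : (forall s, measurable (V s)) ->
  measurable D ->
  P (eta 0%N @^-1` D `&` future 0 N S V) =
  (P (eta 0%N @^-1` D) * P (future 0 N S V))%E.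
Proof.
move=> mV mD.
have finN : finite_set [set s | (0 <= s < N)%N].
  by apply: (@sub_finite_set _ _ `I_N) => // s /= /andP[].
pose HX := \bigcap_(s in [set s | (0 <= s < N)%N]) X s @^-1` S s.
pose HU := \bigcap_(s in [set s | (0 <= s < N)%N]) U s @^-1` V s.
have sHX : (<<s \bigcup_t sigma_site X t >>) HX.
  apply: (@fin_bigcap_measurable _
    (g_sigma_algebraType (\bigcup_t sigma_site X t))) => // s _.
  apply: sub_sigma_algebra; exists s => //.
  by exists (S s) => //; rewrite setTI.
have sHU : (<<s \bigcup_t sigma_real U t >>) HU.
  apply: (@fin_bigcap_measurable _
    (g_sigma_algebraType (\bigcup_t sigma_real U t))) => // s _.
  apply: sub_sigma_algebra; exists s => //.
  by exists (V s) => //; rewrite setTI.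
have HE : future 0 N S V = HX `&` HU by rewrite /future bigcapI.
pose G := preimage_set_system setT (eta 0%N) (@measurable _ (config R Lam)).
have GD : G (eta 0%N @^-1` D) by exists D => //; rewrite setTI.
have GT : G setT by exists setT => //; rewrite setTI preimage_setT.
(* Applied twice: to [D] and to the whole space, the latter giving the probability of the cylinder
   as a product. *)
have ind := independent3 (joint_independent chain) sHX sHU.
have -> : (P (future 0 N S V) = P HX * P HU)%E.
  by have := ind _ GT; rewrite setIT probability_setT mule1 HE.
by rewrite HE setIC (ind _ GD) muleC.
Qed.

Hypothesis stationary : forall B, measurable B ->
  P (eta 0%N @^-1` B) = mu_allowed R d Lam B.

(** Law and independence go through the induction together: a cylinder from time [t.+1] cut by
    conditions on [X t] and [U t] is a cylinder from time [t]. *)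
Lemma chain_independent t N S V D : (forall s, measurable (V s)) ->
  measurable D ->
  P (eta t @^-1` D `&` future t N S V) =
  (mu_allowed R d Lam D * P (future t N S V))%E.
Proof.
elim: t N S V D => [|t IH] N S V D mV mD.
  by rewrite initial_independent// stationary.
(* The law of [eta 0] presents [mu_allowed] as a bundled measure on measurable sets. *)
have [nu nuE] := restricted_law_pack P measurableT (initial_measurable chain).
have nuT B : measurable B -> nu B = mu_allowed R d Lam B.
  by move=> mB; rewrite nuE setIT; exact: stationary.
have mH := measurable_future t.+1 N S mV.
set H := future _ _ _ _ in mH *.
have step x : P (H `&` X t @^-1` [set x] `&` eta t.+1 @^-1` D) =
    (nu D * P (H `&` X t @^-1` [set x]))%E.
  pose G := H `&` X t @^-1` [set x].
  have mG : measurable G.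
    by apply: measurableI => //; exact: site_measurable chain _ _.
  (* The bound [maxn t.+1 N] keeps time [t] in the window when [N <= t]; the times this adds after
     [t] carry the trivial condition. *)
  have GE V0 : G `&` U t @^-1` V0 = future t (maxn t.+1 N)
      (fun s => if s == t then [set x] else if (s < N)%N then S s else setT)
      (fun s => if s == t then V0 else if (s < N)%N then V s else setT).
    apply/seteqP; split => w.
      move=> [[Hw Xw] Uw] s /= /andP[]; rewrite leq_eqVlt => /orP[/eqP <- _|ts].
        by rewrite eqxx.
      rewrite gtn_eqF// leq_max ltnS leqNgt ts/= => sN; rewrite sN.
      by apply: Hw; rewrite /= ts.
    move=> Fw; split; first split.
    - move=> s /= /andP[ts sN]; have := Fw s; rewrite /= gtn_eqF// sN.
      by apply; rewrite (ltnW ts)/= leq_max sN orbT.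
    - by have := Fw t; rewrite /= eqxx leqnn leq_max ltnSn => /(_ isT)[].
    - by have := Fw t; rewrite /= eqxx leqnn leq_max ltnSn => /(_ isT)[].
  have [lam lamE] := restricted_law_pack P mG (measurable_funPT (U t)).
  have lamT : lam setT = P G by rewrite lamE preimage_setT setTI.
  have lamN : lam `]-oo, 0[%classic = 0%E.
    apply/eqP; rewrite eq_le measure_ge0 andbT lamE.
    rewrite -(uniform_law_negative a0 ab (amount_uniform chain t)).
    by apply: le_measure; rewrite ?inE//; [apply: measurableI => //|];
      exact: measurable_preimage.
  have mpair : measurable_fun setT (fun w => (U t w, eta t w)).
    by apply: measurable_fun_pair => //; exact: measurable_chain.
  have [kap kapE] := restricted_law_pack P mG mpair.
  pose C := (fun p : R * config R Lam => add_op x p.1 p.2) @^-1` D.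
  have mC : measurable C.
    exact: measurable_preimage (measurable_add_op_pair x) mD.
  have -> : G `&` eta t.+1 @^-1` D = (fun w => (U t w, eta t w)) @^-1` C `&` G.
    rewrite setIC; apply/seteqP; split => w [Dw [Hw Xw]]; split => //;
    by move: Dw; rewrite /C /preimage /= (chain_step chain) Xw.
  (* On [G] the joint law of [U t] and [eta t] is [lam] times [nu]. By invariance the section of [C]
     at [u >= 0] has measure [nu D], and [lam] does not charge negative [u], so Fubini gives
     [nu D * P G]. *)
  rewrite -[LHS]kapE -(product_measure_unique (m1 := lam) (m2 := nu))//.
    rewrite /product_measure1.
    rewrite (ge0_ae_eq_integral (g := cst (nu D)))//.
    - by rewrite integral_cst//; congr (_ * _)%E; exact: lamT.
    - exact: measurable_fun_xsection.
    - exists `]-oo, 0[%classic; split => //.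
      move=> u; apply: contra_notP; rewrite /= in_itv/= => /negP.
      rewrite -leNgt => u0 _.
      rewrite /= !nuT//; last exact: measurable_xsection.
      rewrite -[RHS](mu_allowed_add_op hd x u0 mD); congr mu_allowed.
      by apply/seteqP; split => z; rewrite /xsection /= inE.
  (* The product formula on rectangles is the induction hypothesis for the enlarged cylinder. *)
  move=> V0 D0 mV0 mD0; rewrite [LHS]kapE -[RHS]/(lam V0 * nu D0)%E lamE.
  rewrite nuT// [U t @^-1` V0 `&` G]setIC muleC GE -IH//; first last.
    by move=> s; case: ifP => // _; case: ifP.
  rewrite -GE; congr (P _); apply/seteqP.
  by split => w; [move=> [[? ?] ?]|move=> [? [? ?]]].
have decomp A : measurable A ->
    P A = (\sum_(x \in [set: Lam]) P (A `&` X t @^-1` [set x]))%E.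
  move=> mA; rewrite -measure_fin_bigcup.
  - by congr (P _); apply/seteqP; split => [w Aw|w [x _ []//]]; exists (X t w).
  - exact: finite_finset.
  - by move=> x y _ _ [w [[_ <-] [_ <-]]].
  - by move=> x _; apply: measurableI => //; exact: site_measurable chain _ _.
rewrite [in LHS]setIC decomp; last first.
  apply: measurableI => //.
  exact: measurable_preimage (measurable_chain t.+1) mD.
rewrite (decomp H)// ge0_mule_fsumr// -(nuT _ mD).
by apply: eq_fsbigr => x _; rewrite setIAC step.
Qed.

End chain.

Theorem theorem2p2 (R : realType) (d : nat) (hd : (1 <= d)%N)
    (Lam : {fset 'rV[int]_d}) (hLam : Lam != fset0) :
  (forall (x : Lam) (u : R), 0 <= u < 1 ->
     set_bij (allowed R d Lam) (allowed R d Lam) (add_op x u) /\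
     forall B : set (config R Lam), measurable B -> B `<=` allowed R d Lam ->
       let preB := [set eta | allowed R d Lam eta /\ B (add_op x u eta)] in
       measurable preB /\ mu_allowed R d Lam preB = mu_allowed R d Lam B) /\
  (forall a b : R, 0 <= a -> a <= b -> b <= 1 ->
     CBTW_invariant a b (mu_allowed R d Lam)).
Proof.
split=> [x u /andP[u0 _]|a b a0 ab _].
  split; first exact: add_op_bij.
  move=> B mB BA; split.
    apply: measurableI; first exact: measurable_allowed.
    exact: measurable_preimage (measurable_add_op x u) mB.
  rewrite /mu_allowed [in RHS](setIidl BA) -(volume_add_op hd x u0 mB BA).
  by rewrite setIidl// => eta [].
move=> disp T P X U eta chain stationary t.
split; first exact: (measurable_chain chain).
move=> B mB.
(* The window from [t] to [t] is empty, which leaves the law of [eta t] alone. *)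
have := chain_independent hd a0 ab chain stationary t t (fun=> setT)
  (V := fun=> setT) (fun=> measurableT) mB.
rewrite /future (_ : [set s | _] = set0).
  by rewrite bigcap_set0 setIT probability_setT mule1.
by apply/seteqP; split => // s /= /andP[ts /(leq_ltn_trans ts)]; rewrite ltnn.
Qed.
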